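(* Let $G$ be an $\omega$-bounded topological group such that one of its finite powers $G^k$ is not a Menger monoid. Then $\mathrm{cf}^\ast_g(G)\leq \mathfrak b(\mathcal L)$ for every ultrafilter $\mathcal L$ on $\omega$ which is not coherent to any $Q$-point.
   Context: Finite powers carry the product topology and coordinatewise operation. The unit is denoted by $1$. A topological group (or, more generally, topological monoid) $X$ is $\omega$-bounded if for every neighborhood $U$ of $1$ there is a countable $C\subset X$ with $X=C\cdot U$. $X$ is a Menger monoid if for every sequence $\langle U_n:n\in\omega\rangle$ of open neighborhoods of $1$ there is a sequence $\langle F_n:n\in\omega\rangle$ of finite subsets of $X$ with $X=\bigcup_{n\in\omega}(F_nU_n\cap U_nF_n)$. A subset $B\subset X$ is totally bounded if for every open neighborhood $U$ of $1$ there is a finite $F\subset X$ with $B\subset FU\cap UF$; $B$ is $\sigma$-bounded if it is a countable union of totally bounded subsets. For a topological group $G$, $\mathrm{cf}^\ast_g(G)$ is the minimal length $\lambda$ of an increasing (with respect to inclusion) chain $\langle G_i:i<\lambda\rangle$ of proper subgroups of $G$ such that $G=\bigcup_{i<\lambda}G_i$ and every $\sigma$-bounded subset $H$ of $G$ is contained in some $G_i$. (The asserted inequality includes the existence of such a chain.) All filters are assumed non-principal. For an ultrafilter $\mathcal F$ on $\omega$ and $x,y\in\omega^\omega$, $x\leq_{\mathcal F}y$ means $\{n:x(n)\leq y(n)\}\in\mathcal F$; $\mathfrak b(\mathcal F)$ is the cofinality of the linearly (pre)ordered set $(\omega^\omega,\leq_{\mathcal F})$. Ultrafilters $\mathcal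 F$ and $\mathcal U$ on $\omega$ are coherent if there is an increasing sequence $\langle k_n:n\in\omega\rangle$ of natural numbers such that for every $I\subset\omega$, $\bigcup_{n\in I}[k_n,k_{n+1})\in\mathcal F$ if and only if $\bigcup_{n\in I}[k_n,k_{n+1})\in\mathcal U$. An ultrafilter $\mathcal L$ is a $Q$-point if for every monotone (nondecreasing) surjection $\phi:\omega\to\omega$ there is $L\in\mathcal L$ such that $\phi\restriction L$ is injective. *)

(* Defs.v *)
From HB Require Import structures.
From mathcomp Require Import all_boot all_classical topology.
From mathcomp Require wochoice.

Set Implicit Arguments.
Unset Strict Implicit.
Unset Printing Implicit Defensive.

Local Open Scope classical_set_scope.
Local Open Scope card_scope.
Local Open Scope group_scope.

(* No separation axiom is imposed on topological monoids and groups. *)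

HB.mixin Record isTopologicalMonoid M
    of Topological M & monoid.Monoid M := {
  mulg_continuous : continuous (fun x : M * M => x.1 * x.2)
}.

#[short(type="topologicalMonoidType")]
HB.structure Definition TopologicalMonoid :=
  {M of Topological M & monoid.Monoid M & isTopologicalMonoid M}.

HB.mixin Record isTopologicalGroup G
    of TopologicalMonoid G & monoid.Group G := {
  invg_continuous : continuous (fun x : G => x^-1)
}.

#[short(type="topologicalGroupType")]
HB.structure Definition TopologicalGroup :=
  {G of TopologicalMonoid G & monoid.Group G & isTopologicalGroup G}.

Definition mpower (M : topologicalMonoidType) (k : nat) : Type :=
  prod_topology (fun _ : 'I_k => (M : topologicalType)).

Section Power.
Variables (M : topologicalMonoidType) (k : nat).

HB.instance Definition _ := Topological.on (mpower M k).

Let mul (x y : mpower M k) : mpower M k := fun i => x i * y i.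
Let one : mpower M k := fun=> 1.

Let mulA : associative mul.
Proof. by move=> x y z; apply/funext => i; exact: mulgA. Qed.

Let mul1 : left_id one mul.
Proof. by move=> x; apply/funext => i; exact: mul1g. Qed.

Let mulr1 : right_id one mul.
Proof. by move=> x; apply/funext => i; exact: mulg1. Qed.

HB.instance Definition _ := isMonoid.Build (mpower M k) mulA mul1 mulr1.

Let mul_continuous :
  continuous (fun x : mpower M k * mpower M k => x.1 * x.2).
Proof.
move=> z; apply/cvg_sup => i.
suff : continuous
    ((fun x => x.1 * x.2 : initial_topology (fun f : mpower M k => f i))
       : mpower M k * mpower M k -> _) by apply.
apply: continuous_comp_initial => {}z.
have projc : continuous (fun f : mpower M k => f i) by exact: proj_continuous.
apply: (@cvg_comp _ _ _ (fun x : mpower M k * mpower M k => (x.1 i, x.2 i))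
  (fun y : M * M => y.1 * y.2) _ _ _ _ (mulg_continuous (z.1 i, z.2 i))).
apply: cvg_pair => /=.
- by apply: (cvg_comp _ (fun f : mpower M k => f i) cvg_fst); exact: projc.
- by apply: (cvg_comp _ (fun f : mpower M k => f i) cvg_snd); exact: projc.
Qed.

HB.instance Definition _ := isTopologicalMonoid.Build (mpower M k) mul_continuous.

End Power.

Section Boundedness.
Variable X : topologicalMonoidType.

Definition setmul (A B : set X) : set X := [set a * b | a in A & b in B].

Definition omega_bounded := forall U : set X, nbhs 1 U ->
  exists2 C : set X, countable C & [set: X] = setmul C U.

Definition menger_monoid := forall U : nat -> set X,
  (forall n, open_nbhs 1 (U n)) ->
  exists2 F : nat -> set X, (forall n, finite_set (F n)) &
    [set: X] = \bigcup_n (setmul (F n) (U n) `&` setmul (U n) (F n)).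

Definition totally_bounded (B : set X) := forall U : set X, open_nbhs 1 U ->
  exists2 F : set X, finite_set F & B `<=` setmul F U `&` setmul U F.

(* Finite unions are covered, as set0 is totally bounded. *)
Definition sigma_bounded (B : set X) := exists2 A : nat -> set X,
  (forall n, totally_bounded (A n)) & B = \bigcup_n A n.

End Boundedness.

(* An ordinal is represented by any well-ordered type of that order type, and
   ordinals are compared by embedding one as an initial segment of the other. *)
Record wotype := WOType {
  wosort :> Type;
  wole : rel wosort;
  wole_wo : wochoice.well_order wole
}.

Definition ord_le (a b : wotype) := exists2 f : a -> b,
  {mono f : x y / wole x y} & forall x z, wole z (f x) -> exists y, f y = z.

Definition is_least (P : wotype -> Prop) (a : wotype) :=
  P a /\ forall b, P b -> ord_le a b.

Definition cfg_chain (G : topologicalGroupType) (a : wotype) :=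
  exists H : a -> set G,
    [/\ forall i, group_closed (mem (H i)) /\ H i <> [set: G],
        forall i j, wole i j -> H i `<=` H j,
        [set: G] = \bigcup_i H i &
        forall B : set G, sigma_bounded B -> exists i, B `<=` H i].

Definition is_cfg (G : topologicalGroupType) := is_least (cfg_chain G).

Definition free_ultrafilter (F : set_system nat) :=
  UltraFilter F /\ forall n, F <> principal_filter n.

Definition le_mod (F : set_system nat) (x y : nat -> nat) :=
  F [set n | x n <= y n]%N.

(* Least cardinality of a cofinal subset, cardinals being initial ordinals. *)
Definition is_cofinality (T : Type) (r : T -> T -> Prop) :=
  is_least (fun a => exists2 D : set T,
    (forall x, exists2 y, D y & r x y) & D #= [set: a]).

Definition is_frakb (F : set_system nat) := is_cofinality (le_mod F).

Definition coherent (F U : set_system nat) := exists2 k : nat -> nat,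
  {homo k : m n / (m < n)%N} &
  forall I : set nat,
    let A := \bigcup_(n in I) [set m | k n <= m < k n.+1]%N in F A <-> U A.

Definition Qpoint (L : set_system nat) := free_ultrafilter L /\
  forall phi : nat -> nat, {homo phi : m n / (m <= n)%N} ->
    set_surj [set: nat] [set: nat] phi -> exists2 A, L A & set_inj A phi.

(* Main.v *)
Require Import Defs.
From mathcomp Require Import all_boot all_classical topology.
From mathcomp Require wochoice.
From mathcomp Require Import zify.

(** Write [b] for the cofinality of [(omega^omega, <=_L)]. It is enough to
    build a covering chain of proper subgroups of length [b]: since nonempty
    classes of well-orders have a least member, the minimal length then exists
    and is at most [b].

    Using omega-boundedness, fix neighborhoods [U n] of the unit with
    [U n.+1 * U n.+1 <= U n] and sequences [c n] such that the translates
    [c n i * U n.+1] cover [G] and, for all [l] and [i], the conjugate of [U m]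
    by [c l i] is inside [U l] for large [m] ([omega_bounded_sequence]). Let [W n j] be the
    set of the [x] such that [x] and [x^-1] lie in one of the first [j]
    translates [c n i * U n], and for [f : nat -> nat] let
    [X f = {x | {n | x \in W n (f n)} \in L}].

    - [X f] increases with [f] for [<=_L], and the [X f] cover [G].
    - Each sigma-bounded set is inside some [X f], because its countably many
      totally bounded pieces give functions with a common eventual bound.
    - [X f <> G] for every [f]. The [U n] can be chosen inside neighborhoods
      whose powers witness that [G^k] is not Menger; this yields a [k]-tuple
      of which, for each [n], some entry is not in [W n (f n)]. As [L] is an
      ultrafilter, one fixed entry fails for [L]-many [n].
    - For every [f] there is [f'] such that [X f * X f <= X f']
      ([dominatedM]). A product [x * y] of [x = c' u'] and [y = c u] equals
      [c' c (c^-1 u' c) u], so it is controlled at [n] once [y] is measured at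
      some [m > n] and [x] at some [m'] large with respect to [m] and [f m].
      A bound on [m'] in terms of [n] that does not depend on [x] and [y] is
      needed. It exists because [L] is not coherent to a Q-point: for each [h]
      there is [h'] such that, for each [A] in [L], [L]-many [n] in [A] have
      some [m] in [A] with [h n <= m <= h' n] ([not_coherent_Qpoint_gap]).

    Iterating the last point and diagonalizing, the subgroup generated by any
    [X f] is inside some [X f'], hence is proper. Enumerate a cofinal subset
    of [omega^omega] as [d] along [b]. By minimality of [b] and linearity of
    [<=_L], every initial segment of [d] is bounded, so the subgroups generated
    by the sets [X (d j)] for [j <= i] form the required chain. *)

Set Implicit Arguments.
Unset Strict Implicit.
Unset Printing Implicit Defensive.

Local Open Scope classical_set_scope.
Local Open Scope card_scope.
Local Open Scope group_scope.

(** * Well-orders *)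

(** The strict order of a well-ordered type. *)
Definition wolt (a : wotype) (x y : a) := ~~ wole y x.

Lemma wo_min (a : wotype) (P : a -> Prop) :
  (exists x, P x) -> exists2 z, P z & forall x, P x -> wole z x.
Proof.
move=> [x Px].
have [|z [[/asboolP Pz zmin] _]] := @wole_wo a (fun x => `[< P x >]).
  by exists x; apply/asboolP.
by exists z => // y Py; apply: zmin; apply/asboolP.
Qed.

Lemma wole_refl (a : wotype) (x : a) : wole x x.
Proof. by have [|z -> ] := @wo_min a (fun y => y = x); [exists x | apply]. Qed.

Lemma wole_total (a : wotype) (x y : a) : wole x y || wole y x.
Proof.
have [|z [] -> zmin] := @wo_min a (fun z => z = x \/ z = y).
- by exists x; left.
- by rewrite zmin//; right.
- by rewrite (zmin x) ?orbT//; left.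
Qed.

Lemma wole_anti (a : wotype) (x y : a) : wole x y -> wole y x -> x = y.
Proof.
move=> xy yx; pose A := fun z => `[< z = x \/ z = y >].
have [|z [_ zuniq]] := @wole_wo a A; first by exists x; apply/asboolP; left.
have Am w : A w -> (w = x \/ w = y) by move=> /asboolP.
rewrite -(zuniq x); last first.
  by split=> [|w /Am[]->]; rewrite ?wole_refl//; apply/asboolP; left.
rewrite -(zuniq y)//; split=> [|w /Am[]->]; rewrite ?wole_refl//.
by apply/asboolP; right.
Qed.

Lemma wole_trans (a : wotype) (x y z : a) : wole x y -> wole y z -> wole x z.
Proof.
move=> xy yz.
have [|w ww wmin] := @wo_min a (fun w => [\/ w = x, w = y | w = z]).
  by exists x; constructor 1.
have wx : wole w x by apply: wmin; constructor 1.
have wy : wole w y by apply: wmin; constructor 2.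
have wz : wole w z by apply: wmin; constructor 3.
case: ww => wE; subst w => //.
- by rewrite (wole_anti xy wx).
- by rewrite -(wole_anti yz wy).
Qed.

Lemma woltW (a : wotype) (x y : a) : wolt x y -> wole x y.
Proof. by move=> /negPf yx; have := wole_total x y; rewrite yx orbF. Qed.

Lemma wolt_wole_trans (a : wotype) (y x z : a) :
  wolt x y -> wole y z -> wolt x z.
Proof. by move=> xy yz; apply: contra xy => /(wole_trans yz). Qed.

Lemma wole_eqVlt (a : wotype) (x y : a) : wole x y -> x = y \/ wolt x y.
Proof.
by move=> xy; have [/(wole_anti xy)->|yx] := boolP (wole y x); [left|right].
Qed.

Lemma wolt_wf (a : wotype) : well_founded (@wolt a).
Proof.
move=> x; apply: contrapT => xNacc.
have [|z zNacc zmin] := @wo_min a (fun x => ~ Acc (@wolt a) x); first by exists x.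
apply: zNacc; constructor => y yz; apply: contrapT => /zmin.
exact/negP.
Qed.

(** The initial segment of the elements strictly below [x]. *)
Definition seg_type (a : wotype) (x : a) := {y : a | wolt y x}.

Lemma seg_well_order (a : wotype) (x : a) :
  wochoice.well_order (fun y z : seg_type x => wole (sval y) (sval z)).
Proof.
apply: wochoice.antisymmetric_well_order => [[y ?] [z ?] /= /andP[yz zy]|A [[y yx] Ay]].
  by apply: eq_exist; exact: wole_anti.
have [|z [zx Az] zmin] :=
    @wo_min a (fun y => exists yx : wolt y x, exist _ y yx \in A).
  by exists y, yx.
exists (exist _ z zx); split=> // -[w wx] Aw.
by apply: zmin; exists wx.
Qed.

Definition seg (a : wotype) (x : a) : wotype := WOType (@seg_well_order a x).

(** Isomorphism of well-orders; injectivity follows from monotonicity. *)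
Definition ord_iso (a b : wotype) := exists2 f : a -> b,
  {mono f : x y / wole x y} & forall z, exists y, f y = z.

Lemma wole_mono_inj (a b : wotype) (f : a -> b) :
  {mono f : x y / wole x y} -> injective f.
Proof.
by move=> fm x y xy; apply: wole_anti; rewrite -fm xy wole_refl.
Qed.

Lemma ord_iso_sym (a b : wotype) : ord_iso a b -> ord_iso b a.
Proof.
move=> [f fm /choice[g fg]]; exists g => [x y|x].
  by rewrite -fm !fg.
by exists (f x); apply: (wole_mono_inj fm).
Qed.

Lemma ord_le_trans (b a c : wotype) : ord_le a b -> ord_le b c -> ord_le a c.
Proof.
move=> [f fm fi] [g gm gi]; exists (g \o f) => [x y|x z /= zgf].
  by rewrite /= gm fm.
have [y yz] := gi _ _ zgf; move: zgf; rewrite -yz gm => /fi[w <-].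
by exists w.
Qed.

Lemma ord_iso_le (a b : wotype) : ord_iso a b -> ord_le a b.
Proof. by move=> [f fm fs]; exists f. Qed.

Lemma seg_ord_le (a : wotype) (x : a) : ord_le (seg x) a.
Proof.
exists (fun y : seg_type x => sval y) => // -[y yx] z /= zy.
have zx : wolt z x by apply: contra yx => /wole_trans; exact.
by exists (exist _ z zx).
Qed.

Lemma seg_le_seg (a : wotype) (x y : a) : wole x y -> ord_le (seg x) (seg y).
Proof.
move=> xy; exists (fun z : seg_type x =>
  exist (fun w => wolt w y) (sval z) (wolt_wole_trans (proj2_sig z) xy)) => //.
move=> -[z zx] [w wy] /= wz.
have wx : wolt w x by apply: contra zx => /wole_trans; exact.
by exists (exist _ w wx); apply: eq_exist.
Qed.

(** A strictly monotone self-map of a well-order is nowhere regressive, so no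
   well-order embeds into a proper initial segment of itself. *)
Lemma ord_le_segN (a : wotype) (x : a) : ~ ord_le a (seg x).
Proof.
move=> [f fm _].
have [|z fz zmin] := @wo_min a (fun z => wolt (sval (f z)) z).
  by exists x; exact: (proj2_sig (f x)).
have /zmin : wolt (sval (f (sval (f z)))) (sval (f z)).
  by have := fm z (sval (f z)); rewrite /wolt /= => ->.
exact/negP.
Qed.

(** Two well-orders are comparable: by recursion, [f x] is the least element of
    [b] not taken by [f] below [x], and [None] once [b] is exhausted. *)
Lemma ord_compare (a b : wotype) :
  ord_le a b \/ exists x : a, ord_iso (seg x) b.
Proof.
pose least (S : set b) : option b :=
  if pselect (exists z, S z) is left h then Some (sval (cid2 (wo_min h)))
  else None.
have leastP S z : least S = Some z -> S z /\ forall w, S w -> wole z w.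
  by rewrite /least; case: pselect => // h [<-]; case: cid2.
have leastN S : least S = None -> forall z, ~ S z.
  by rewrite /least; case: pselect => // h _ z Sz; apply: h; exists z.
pose f := Fix (@wolt_wf a) (fun=> option b) (fun x rec =>
  least [set z | forall y (yx : wolt y x), rec y yx <> Some z]).
have fE x : f x = least [set z | forall y, wolt y x -> f y <> Some z].
  rewrite /f Fix_eq// => {}x g h gh; congr least; apply/funext => z.
  by apply/propext; split => H y yx; [rewrite -gh|rewrite gh].
have f_le x y u v : f x = Some u -> f y = Some v -> wole x y -> wole u v.
  rewrite !fE => /leastP[_ umin] /leastP[vS _] xy; apply: umin => z zx.
  exact/vS/(wolt_wole_trans zx).
have f_lt x y u v : f x = Some u -> f y = Some v -> wolt x y -> u <> v.
  move=> fx fy xy uv; move: (fy); rewrite fE => /leastP[+ _].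
  by move=> /(_ _ xy); rewrite fx uv.
have f_mono x y u v : f x = Some u -> f y = Some v -> wole u v = wole x y.
  move=> fx fy; apply/idP/idP => [uv|]; last exact: f_le fx fy.
  apply: contraT => yx; have vu := f_le _ _ _ _ fy fx (woltW yx).
  by have := f_lt _ _ _ _ fy fx yx; rewrite (wole_anti uv vu).
have f_init x u z : f x = Some u -> wole z u -> exists y, f y = Some z.
  move=> fx /wole_eqVlt[->|zu]; first by exists x.
  move: fx; rewrite fE => /leastP[_ umin].
  apply: contrapT => fz; apply: (negP zu); apply: umin => y _ fy.
  by apply: fz; exists y.
have [[x fx]|fT] := pselect (exists x, f x = None); [right|left].
  have [x0 fx0 x0min] := @wo_min a (fun x => f x = None) (ex_intro _ x fx).
  have /choice[g fg] (y : seg x0) : exists u, f (sval y) = Some u.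
    case fy : (f (sval y)) => [u|]; first by exists u.
    by have := x0min _ fy; rewrite (negPf (proj2_sig y)).
  exists x0, g => [y z|z]; first exact: f_mono.
  have := fx0; rewrite fE => /leastN/(_ z)/= /existsNP[y].
  move=> /not_implyP[yx /contrapT fy]; exists (exist _ y yx).
  by apply/Some_inj; rewrite -fg.
have /choice[g fg] x : exists u, f x = Some u.
  by case fx : (f x) => [u|]; [exists u|case: fT; exists x].
exists g => [x y|x z /(f_init _ _ _ (fg x))[y fy]]; first exact: f_mono.
by exists y; apply/Some_inj; rewrite -fg.
Qed.

(** A class of well-orders closed under isomorphism has a least member: if the
    given member is not the least one, then the comparisons produce members
    among its initial segments, and the shortest of these is the least. *)
Lemma least_exists (P : wotype -> Prop) :
  (forall a b, ord_iso a b -> P a -> P b) ->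
  (exists a, P a) -> exists a, is_least P a.
Proof.
move=> Piso [a Pa].
have Pseg b : P b -> ord_le a b \/ exists2 x : a, P (seg x) & ord_iso (seg x) b.
  move=> Pb; have [|[x xb]] := ord_compare a b; [by left|right].
  by exists x => //; apply: Piso Pb; exact: ord_iso_sym.
have [/wo_min[x Px xmin]|nP] := pselect (exists x : a, P (seg x)).
  exists (seg x); split=> // b /Pseg[ab|[y Py yb]].
    exact: ord_le_trans (seg_ord_le x) ab.
  exact: ord_le_trans (seg_le_seg (xmin _ Py)) (ord_iso_le yb).
by exists a; split=> // b /Pseg[//|[y Py _]]; case: nP; exists y.
Qed.

Lemma is_least_segN (P : wotype -> Prop) (a : wotype) (x : a) :
  is_least P a -> ~ P (seg x).
Proof. by move=> [_ amin] /amin; exact: ord_le_segN. Qed.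

(** * Ultrafilters not coherent to a Q-point *)

Lemma free_ultrafilter_tail (L : set_system nat) (N : nat) :
  free_ultrafilter L -> L [set m | N <= m]%N.
Proof.
move=> [LU Lfree]; elim: N => [|N IH]; first exact: filterS filterT.
have [LN|LNC] := in_ultra_setVsetC [set N] LU.
  case: (Lfree N); apply/esym/max_filter; first exact: principal_filter_proper.
  by move=> A LA; have [x [Ax <-]] := filter_ex (filterI LA LN);
    exact/principal_filterP.
apply: filterS (filterI IH LNC) => m /= [Nm /eqP mN].
by rewrite ltn_neqAle eq_sym mN.
Qed.

Lemma fmap_ultra (T U : Type) (g : T -> U) (L : set_system T) :
  UltraFilter L -> UltraFilter (g @ L).
Proof.
move=> LU; split=> [|H HP LH]; first exact: fmap_proper_filter.
apply/seteqP; split => // B HB.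
have [//|/(LH (~` B)) HBC] := in_ultra_setVsetC (g @^-1` B) LU.
by have [x []] := filter_ex (filterI HB HBC).
Qed.

(** The intervals [[k i, k i.+1)] cover the natural numbers when [k 0 = 0]. *)
Lemma block_index (k : nat -> nat) (m : nat) : k 0 = 0%N ->
  {homo k : m n / (m < n)%N} -> exists i, (k i <= m < k i.+1)%N.
Proof.
move=> k0 kinc; elim: m => [|m [i /andP[im mi]]].
  by exists 0%N; rewrite k0 /= -{1}k0 kinc.
have [mi'|mi'] := ltnP m.+1 (k i.+1); first by exists i; rewrite mi' leqW.
by exists i.+1; rewrite mi' /= (leq_ltn_trans _ (kinc i.+1 i.+2 _)).
Qed.

Lemma incn_ge (k : nat -> nat) (i : nat) :
  {homo k : m n / (m < n)%N} -> (i <= k i)%N.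
Proof. by move=> kinc; elim: i => // i /leq_ltn_trans; apply; apply: kinc. Qed.

(** Cut [nat] into blocks [[k i, k i.+1)] such that [h] is at most [k i.+2] on the
    block [i]. The image [Q] of [L] by the map [g] sending [n] to the minimum of
    its block is coherent to [L], so some monotone surjection [psi] is injective
    on no member of [Q]. The value [h' n] bounds the blocks whose minimum has
    the same image by [psi] as [g n]. If the conclusion failed for [A], then
    some [S] in [L], inside [A] and inside blocks of a fixed parity, would
    contain no two elements of different blocks whose minima have the same
    image by [psi], so [psi] would be injective on [g @` S]. *)
Lemma not_coherent_Qpoint_gap (L : set_system nat) (h : nat -> nat) :
  free_ultrafilter L ->
  (forall Q : set_system nat, Qpoint Q -> ~ coherent L Q) ->
  exists h' : nat -> nat, forall A, L A ->
    L [set n | A n /\ exists2 m, A m & (h n <= m <= h' n)%N].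
Proof.
move=> Lfree LnQ; have LU : UltraFilter L by case: Lfree.
pose k := fix k i := if i is j.+1 then (k j + \max_(n < k j) h n).+1 else 0%N.
have kS i : (k i < k i.+1)%N by rewrite /= ltnS leq_addr.
have kinc : {homo k : m n / (m < n)%N} by exact: homo_ltn ltn_trans kS.
have kle : {homo k : m n / (m <= n)%N} by exact: ltnW_homo.
have hk i n : (n < k i -> h n <= k i.+1)%N.
  move=> nk; rewrite /= -[n]/(val (Ordinal nk)) -/k leqW//.
  by apply: leq_trans (leq_addl _ _); exact: leq_bigmax.
have k0 : k 0 = 0%N by [].
clearbody k.
have /choice[idx idxP] m := @block_index k m k0 kinc.
have idx_uniq m i : (k i <= m < k i.+1)%N -> idx m = i.
  move=> /andP[im mi]; have /andP[jm mj] := idxP m.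
  apply/eqP; rewrite eqn_leq; apply/andP; split; rewrite leqNgt;
    by apply/negP => /kle; lia.
pose g n := k (idx n).
pose Q := g @ L.
have QU : UltraFilter Q by exact: fmap_ultra.
have Qfree : free_ultrafilter Q.
  split=> // n QE.
  have : Q [set n] by rewrite QE; exact/principal_filterP.
  rewrite /Q /= => /filterI/(_ (free_ultrafilter_tail (k n.+1) Lfree)).
  move=> /filter_ex[m /= [gm km]].
  have := idxP m; rewrite -/(g m) gm => /andP[_].
  have : (idx m <= n)%N by rewrite -gm; exact: incn_ge.
  by rewrite -ltnS => /kle; lia.
have LQ : coherent L Q.
  exists k => // I /=; rewrite /Q /=.
  suff -> : g @^-1` (\bigcup_(n in I) [set m | (k n <= m < k n.+1)%N]) =
    \bigcup_(n in I) [set m | (k n <= m < k n.+1)%N] by [].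
  apply/seteqP; split => m [i Ii /= mi]; exists i => //=.
    suff <- : idx m = i by [].
    have /andP[im mi'] : (k i <= k (idx m) < k i.+1)%N := mi.
    by have [/kinc|/kle|//] := ltngtP (idx m) i; lia.
  by rewrite /g (idx_uniq _ _ mi) leqnn kS.
have [psi [psi_homo psi_surj psiN]] : exists psi : nat -> nat,
  [/\ {homo psi : m n / (m <= n)%N}, set_surj [set: nat] [set: nat] psi &
      forall A, Q A -> ~ set_inj A psi].
  apply: contrapT => nex; apply: (LnQ Q) LQ; split=> // psi psi_homo psi_surj.
  apply: contrapT => nA; apply: nex; exists psi; split=> // A QA Ainj.
  by apply: nA; exists A.
have /choice[next nextP] n : exists p, psi p = (psi n).+1.
  by have [p _ pE] := psi_surj (psi n).+1 I; exists p.
exists (fun n => k (next (g n))) => A LA.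
set good := [set n | _].
have [//|/(filterI LA) LS] := in_ultra_setVsetC good LU.
(* Fixing the parity of the blocks leaves a gap of one block between any two,
   hence room for [h]. *)
have {LS} [b LS] : exists b, L (A `&` ~` good `&` [set n | odd (idx n) = b]).
  have [Lo|Lo] := in_ultra_setVsetC [set n | odd (idx n)] LU.
    by exists true; exact: filterI.
  exists false; apply: filterS (filterI LS Lo) => n [An /negP/negPf].
  by split.
set S := _ `&` _ in LS.
have Sgap n m : S n -> S m -> psi (g n) = psi (g m) -> ~ (idx n < idx m)%N.
  move=> [[An nn] bn] [[Am _] bm] gnm nm; apply: nn; split=> //; exists m => //.
  have /andP[km mk] := idxP m; have /andP[kn nk] := idxP n.
  have nm2 : ((idx n).+2 <= idx m)%N.
    rewrite ltn_neqAle nm andbT; apply/eqP => nmE.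
    by move: bm; rewrite /= -nmE /= bn; case: (b).
  apply/andP; split.
    exact: leq_trans (leq_trans (hk _ _ nk) (kle _ _ nm2)) km.
  apply/ltnW/(leq_trans mk)/kle; apply: leq_ltn_trans (incn_ge _ kinc) _.
  rewrite -/(g m) ltnNge; apply/negP => /psi_homo.
  by rewrite nextP -gnm ltnn.
have QS : L (g @^-1` (g @` S)) by apply: filterS LS => n Sn; exists n.
case: (psiN _ QS).
move=> _ _ /set_mem[n Sn <-] /set_mem[m Sm <-] gnm.
have [nm|mn|nmE] := ltngtP (idx n) (idx m); first by case: (Sgap _ _ Sn Sm).
  by case: (Sgap _ _ Sm Sn).
by rewrite /g nmE.
Qed.

(** * Subsets of a group dominated along an ultrafilter *)

(** Symmetric coverings [W n] of a group, increasing in the second index. The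
    law [gc_mul] says that products of elements of [W m j] are controlled at each
    index [n] with [n.+1 < m] as soon as both factors also lie in some
    [W m' j'] with [m'] large; only [m'], and not [j'], has to be large. *)
Record graded_cover (G : groupType) (W : nat -> nat -> set G) : Prop := {
  gc_mono : forall n i j, (i <= j)%N -> W n i `<=` W n j;
  gc_cover : forall x n, exists j, W n j x;
  gc_inv : forall n j x, W n j x -> W n j x^-1;
  gc_mul : forall m j, exists h, forall m' j' n,
    (h <= m')%N -> (n.+1 < m)%N -> exists j'', forall x y,
    W m j x -> W m' j' x -> W m j y -> W m' j' y -> W n j'' (x * y)
}.

(** The elements [x] that lie in [W n (b n)] for [L]-many [n]. *)
Definition dominated (G : groupType) (W : nat -> nat -> set G)
    (L : set_system nat) (b : nat -> nat) : set G :=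
  [set x | L [set n | W n (b n) x]].

(** Countably many functions have a common eventual bound. *)
Lemma diagonal_bound (y : nat -> nat -> nat) :
  exists z : nat -> nat, forall l n, (l <= n)%N -> (y l n <= z n)%N.
Proof.
exists (fun n => \max_(l < n.+1) y l n) => l n ln.
by rewrite -ltnS in ln; exact: (@leq_bigmax _ (fun l : 'I_n.+1 => y l n) (Ordinal ln)).
Qed.

Section Dominated.
Variables (G : groupType) (W : nat -> nat -> set G) (L : set_system nat).
Hypothesis WG : graded_cover W.
Hypothesis Lfree : free_ultrafilter L.
Local Notation X := (dominated W L).

Local Instance L_filter : Filter L.
Proof. by have LU : UltraFilter L := proj1 Lfree; exact: _. Qed.

Lemma dominatedS b c : le_mod L b c -> X b `<=` X c.
Proof.
move=> bc x Xx; apply: filterS (filterI bc Xx) => n [/= bcn].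
exact: (gc_mono WG).
Qed.

Lemma dominatedW b c : (forall n, b n <= c n)%N -> X b `<=` X c.
Proof. by move=> bc; apply: dominatedS; apply: filterS filterT => n _; exact: bc. Qed.

Lemma dominated_all (x : G) : exists f, X f x.
Proof.
have /choice[f fP] n := gc_cover WG x n.
by exists f; apply: filterS filterT => n _; exact: fP.
Qed.

Lemma dominatedV b x : X b x -> X b x^-1.
Proof. by apply: filterS => n; exact: (gc_inv WG). Qed.

Hypothesis Lgap : forall h : nat -> nat, exists h' : nat -> nat,
  forall A, L A -> L [set n | A n /\ exists2 m, A m & (h n <= m <= h' n)%N].

(** Two applications of the gap property give, for [L]-many [n], indices
    [n.+1 < m <= h' n] and [m' <= h' m] at which [x] and [y] are both measured;
    the new bound is the maximum over these finitely many possibilities. *)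
Lemma dominatedM b : exists b', forall x y, X b x -> X b y -> X b' (x * y).
Proof.
have /choice[h hP] m := gc_mul WG m (b m).
have /choice[J JP] (t : nat * nat * nat) : exists j'',
    (h t.1.1 <= t.1.2)%N -> (t.2.+1 < t.1.1)%N -> forall x y,
    W t.1.1 (b t.1.1) x -> W t.1.2 (b t.1.2) x ->
    W t.1.1 (b t.1.1) y -> W t.1.2 (b t.1.2) y -> W t.2 j'' (x * y).
  move: t => [[m m'] n] /=.
  have [hm|] := leqP (h m) m'; last by exists 0%N.
  have [nm|] := ltnP n.+1 m; last by exists 0%N.
  by have [j'' j''P] := hP _ _ (b m') _ hm nm; exists j''.
have [h' h'P] := Lgap (fun n => maxn n.+2 (h n)).
exists (fun n => \max_(m < (h' n).+1) \max_(m' < (h' m).+1) J (m : nat, m' : nat, n)).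
move=> x y Xx Xy.
apply: filterS (h'P _ (h'P _ (filterI Xx Xy))) => n [_ [m [[Wx Wy]]]].
move=> [m' [Wx' Wy']] mm' nm.
have mh : (m < (h' n).+1)%N by lia.
have m'h : (m' < (h' m).+1)%N by lia.
have := JP (m, m', n); rewrite /= => /(_ _ _ x y) JW.
apply: (gc_mono WG) (JW _ _ Wx Wx' Wy Wy'); [|lia..].
apply: leq_trans (@leq_bigmax _ (fun m0 : 'I__ => _) (Ordinal mh)).
exact: (@leq_bigmax _ (fun m0 : 'I_(h' m).+1 => J (m, m0 : nat, n)) (Ordinal m'h)).
Qed.

(** [X b] generates a group inside some [X b']: close [X b] under products
    countably many times, and bound all the resulting functions at once. *)
Lemma dominated_group b : exists K b',
  [/\ group_closed (mem K), X b `<=` K & K `<=` X b'].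
Proof.
have [p pP] := choice dominatedM.
have [f1 X1] := dominated_all 1.
pose y := fix y n := if n is m.+1 then fun i => maxn (y m i) (p (y m) i)
                     else fun i => maxn (b i) (f1 i).
have y_homo : {homo y : m n / (m <= n)%N >-> X m `<=` X n}.
  apply: homo_leq => [?|? ? ? |m]; [exact: subset_refl|exact: subset_trans|].
  by apply: dominatedW => n; exact: leq_maxl.
have [z zP] := diagonal_bound y.
exists (\bigcup_n X (y n)), z; split.
- split=> [|u v].
    by apply/mem_set; exists 0%N => //; apply: dominatedW X1 => n; exact: leq_maxr.
  move=> /set_mem[m _ Xu] /set_mem[n _ Xv].
  apply/mem_set; exists (maxn m n).+1 => //.
  apply: (@dominatedW (p (y (maxn m n)))) => [i|]; first exact: leq_maxr.
  apply: pP; first exact: y_homo (leq_maxl _ _) _ Xu.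
  by apply: dominatedV; exact: y_homo (leq_maxr _ _) _ Xv.
- by move=> x Xx; exists 0%N => //; apply: dominatedW Xx => n; exact: leq_maxl.
- move=> x [n _]; apply: dominatedS.
  by apply: filterS (free_ultrafilter_tail n Lfree) => i; exact: zP.
Qed.

End Dominated.

Lemma le_mod_total (L : set_system nat) (x y : nat -> nat) :
  UltraFilter L -> le_mod L x y \/ le_mod L y x.
Proof.
move=> LU; have [|xy] := in_ultra_setVsetC [set n | (x n <= y n)%N] LU; [by left|].
by right; apply: filterS xy => n /= /negP; rewrite -ltnNge => /ltnW.
Qed.

(** The whole type is cofinal, and it can be well-ordered. *)
Lemma is_cofinality_exists (T : Type) (r : T -> T -> Prop) :
  (forall x, r x x) -> exists a, is_cofinality r a.
Proof.
move=> rxx; apply: least_exists => [a b [f fm fs] [D Dcof Da]|].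
  exists D => //; apply: card_eq_trans Da _.
  suff <- : f @` [set: a] = [set: b].
    by apply/card_esym/inj_card_eq => x y _ _; exact: wole_mono_inj.
  by apply/seteqP; split => // z _; have [y <-] := fs z; exists y.
have [R Rwo] := wochoice.well_ordering_principle {classic T}.
by exists (WOType Rwo), [set: T] => // x; exists x.
Qed.

(** A cofinal family indexed by the cofinality has bounded initial segments:
    a segment is too short to be cofinal, and [<=_L] is linear. *)
Lemma is_frakb_cofinal (L : set_system nat) (a : wotype) : is_frakb L a ->
  exists2 d : a -> nat -> nat, (forall x, exists i, le_mod L x (d i)) &
  UltraFilter L -> forall i, exists y, forall j, wole j i -> le_mod L (d j) y.
Proof.
move=> amin; have [[D Dcof Da] _] := amin.
have /pcard_eqP[d] := card_esym Da.
have dinj : injective d by move=> i j; apply: inj; rewrite inE.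
have dD i : D (d i) by exact: funS.
have dsurj y : D y -> exists i, d i = y.
  by move=> Dy; have [i _ <-] := @surj _ _ _ _ d y Dy; exists i.
exists d => [x|LU i].
  by have [y /dsurj[i <-] xy] := Dcof x; exists i.
have [y yP] : exists y, forall j, wolt j i -> le_mod L (d j) y.
  apply: contrapT => nex; apply: (is_least_segN (x := i) amin).
  exists ((fun j : seg i => d (sval j)) @` [set: seg i]); last first.
    by apply: inj_card_eq => -[j ji] [l li] _ _ /dinj /= jl; exact: eq_exist.
  move=> x; apply: contrapT => nx; apply: nex; exists x => j ji.
  have [//|xj] := le_mod_total (d j) x LU.
  by case: nx; exists (d j) => //; exists (exist _ j ji).
exists (fun n => maxn (y n) (d i n)) => j /wole_eqVlt[->|/yP].
  by apply: filterS filterT => n _; exact: leq_maxr.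
by apply: filterS => n /= /leq_trans; apply; exact: leq_maxl.
Qed.

(** The [i]-th subgroup is generated by the [X (d j)], [j <= i], where [d] is a
    cofinal family. It is proper because these sets lie in a single [X y],
    which generates a group inside some [X b']. *)
Lemma cfg_chain_frakb (G : topologicalGroupType) (W : nat -> nat -> set G)
    (L : set_system nat) (kappa : wotype) :
  graded_cover W ->
  (forall B, totally_bounded B -> forall n, exists j, B `<=` W n j) ->
  free_ultrafilter L ->
  (forall h : nat -> nat, exists h' : nat -> nat,
    forall A, L A -> L [set n | A n /\ exists2 m, A m & (h n <= m <= h' n)%N]) ->
  (forall f, exists x, ~ dominated W L f x) ->
  is_frakb L kappa -> cfg_chain G kappa.
Proof.
move=> WG Wtb Lfree Lgap Xproper /is_frakb_cofinal[d dcof dbnd].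
have LU : UltraFilter L by case: Lfree.
pose X := dominated W L.
exists (fun i x => forall K : set G, group_closed (mem K) ->
  (forall j, wole j i -> X (d j) `<=` K) -> K x).
split.
- move=> i; split.
    split=> [|x y /set_mem Kx /set_mem Ky].
      by apply/mem_set => K [K1 _] _; exact/set_mem.
    apply/mem_set => K Kg XK; apply/set_mem; case: (Kg) => _; apply; apply/mem_set.
      exact: Kx.
    exact: Ky.
  move=> HT; have [y yP] := dbnd LU i.
  have [K [b' [Kg XK Kb']]] := dominated_group WG Lfree Lgap y.
  have [x] := Xproper b'; apply; apply: Kb'.
  have : [set: G] x by []. rewrite -HT; apply=> // j /yP jy.
  by apply: subset_trans XK; exact: dominatedS.
- move=> i j ij x Hx K Kg XK; apply: Hx => // l li; apply: XK.
  exact: wole_trans ij.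
- apply/seteqP; split=> // x _.
  have [f Xf] := dominated_all WG Lfree x.
  have [i fi] := dcof f; exists i => // K _ /(_ i (wole_refl i)); apply.
  exact: dominatedS fi _ Xf.
- move=> _ [A Atb ->].
  have /choice[g gP] (t : nat * nat) : exists j, A t.1 `<=` W t.2 j.
    exact: Wtb.
  have [z zP] := diagonal_bound (fun l n => g (l, n)).
  have [i zi] := dcof z; exists i => x [l _ Ax] K _ /(_ i (wole_refl i)); apply.
  apply: (dominatedS WG Lfree zi).
  apply: filterS (free_ultrafilter_tail l Lfree) => n /= ln.
  by apply: (gc_mono WG) (zP _ _ ln) _ _; exact: (gP (l, n)).
Qed.

(** * Bounded topological groups *)

Section NbhsOne.
Variable G : topologicalGroupType.
Implicit Types (U V : set G) (c x y u : G).

Lemma cvgMg (T : Type) (F : set_system T) (f g : T -> G) x y : Filter F ->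
  f @ F --> x -> g @ F --> y -> (fun t => f t * g t) @ F --> x * y.
Proof.
move=> FF fx gy.
have := @mulg_continuous G (x, y).
by apply: (@cvg_comp _ _ _ (fun t => (f t, g t))); exact: cvg_pair.
Qed.

Lemma nbhs1_conj U c : nbhs 1 U -> nbhs 1 [set u | U (c^-1 * u * c)].
Proof.
have : (fun u => c^-1 * u * c) @ (1 : G) --> c^-1 * 1 * c.
  by do 2?apply: cvgMg; [exact: cvg_cst|exact: cvg_id|exact: cvg_cst].
by rewrite mulg1 mulVg; apply.
Qed.

Lemma nbhs1V U : nbhs 1 U -> nbhs 1 [set u | U u^-1].
Proof.
have : (fun x : G => x^-1) @ (1 : G) --> (1 : G)^-1 by exact: invg_continuous.
by rewrite invg1; apply.
Qed.

Lemma nbhs1_sqrt U : nbhs 1 U ->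
  exists2 V, nbhs 1 V & forall x y, V x -> V y -> U (x * y).
Proof.
have : (fun z : G * G => z.1 * z.2) @ ((1 : G), (1 : G)) --> (1 : G) * (1 : G).
  exact: (@mulg_continuous G (1, 1)).
rewrite mulg1 => /[apply].
move=> [[A B] /= [A1 B1] AB]; exists (A `&` B); first exact: filterI.
by move=> x y [Ax _] [_ By]; exact: (AB (x, y)).
Qed.

Lemma omega_bounded_enum U : omega_bounded G -> nbhs 1 U ->
  exists c : nat -> G, forall x, exists i, U ((c i)^-1 * x).
Proof.
move=> Gob /Gob[C /pfcard_geP[->|[e]] CU].
  have : [set: G] 1 by []. by rewrite CU => -[? []].
exists e => x; have : [set: G] x by []. rewrite CU => -[y Cy [u Uu <-]].
by have [i _ <-] := @surj _ _ _ _ e y Cy; exists i; rewrite mulKg.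
Qed.

(** One step of the construction of the neighborhoods, with finitely many
    conjugation constraints. *)
Lemma nbhs1_step U V (K : nat -> nat -> G) n : nbhs 1 U -> nbhs 1 V ->
  exists U', [/\ nbhs 1 U', forall x y, U' x -> U' y -> U (x * y), U' `<=` V &
    forall l i, (l < n)%N -> (i <= n)%N -> forall u, U' u ->
      U ((K l i)^-1 * u * K l i)].
Proof.
move=> U1 V1; have [W W1 WW] := nbhs1_sqrt U1.
pose conj (t : 'I_n * 'I_n.+1) : set G :=
  [set u | U ((K t.1 t.2)^-1 * u * K t.1 t.2)].
have C1 : \forall u \near (1 : G), forall t, conj t u.
  by apply: filter_forall => t; exact: nbhs1_conj.
exists (W `&` V `&` [set u | forall t, conj t u]); split.
- by apply: filterI => //; exact: filterI.
- by move=> x y [[Wx _] _] [[Wy _] _]; exact: WW.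
- by move=> x [[]].
- move=> l i ln i_n u [_ /(_ (Ordinal ln, Ordinal (i_n : (i < n.+1)%N)))].
  exact.
Qed.

(** The sequence [c n] enumerates a covering set for [U n.+1], not only for
    [U n], which leaves room for one more multiplication. *)
Lemma omega_bounded_sequence (V : nat -> set G) :
  omega_bounded G -> (forall n, nbhs 1 (V n)) ->
  exists (U : nat -> set G) (c : nat -> nat -> G),
  [/\ [/\ forall n, nbhs 1 (U n), forall n, U n `<=` V n &
          forall n x y, U n.+1 x -> U n.+1 y -> U n (x * y)],
      forall n x, exists i, U n.+1 ((c n i)^-1 * x) &
      forall l i n, (l < n)%N -> (i <= n)%N -> forall u, U n.+1 u ->
        U n ((c l i)^-1 * u * c l i)].
Proof.
move=> Gob V1.
have /choice[en enP] (U : set G) : exists c : nat -> G,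
    nbhs 1 U -> forall x, exists i, U ((c i)^-1 * x).
  have [/(omega_bounded_enum Gob)[c cP]|nU] := pselect (nbhs 1 U).
    by exists c.
  by exists (fun=> 1).
have /choice[nxt nxtP] (t : nat * set G * (nat -> nat -> G)) : exists U',
    nbhs 1 t.1.2 -> [/\ nbhs 1 U', forall x y, U' x -> U' y -> t.1.2 (x * y),
    U' `<=` V t.1.1.+1 & forall l i, (l < t.1.1)%N -> (i <= t.1.1)%N ->
      forall u, U' u -> t.1.2 ((t.2 l i)^-1 * u * t.2 l i)].
  have [t1|nt] := pselect (nbhs 1 t.1.2); last by exists setT.
  by have [U' U'P] := nbhs1_step t.2 t.1.1 t1 (V1 t.1.1.+1); exists U'.
(* The state at [n] holds [U n] and the sequences [c l] for [l < n]. *)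
pose st := fix st n := if n is m.+1 then
    let U' := nxt (m, (st m).1, (st m).2) in
    (U', fun l => if l == m then en U' else (st m).2 l)
  else (V 0%N, fun _ _ => 1).
pose U n := (st n).1; pose c n := en (U n.+1).
have U1 n : nbhs 1 (U n).
  by elim: n => [|n /(nxtP (n, U n, (st n).2))[]//]; exact: V1.
have stc n l : (l < n)%N -> (st n).2 l = c l.
  elim: n => // n IH ln; rewrite [st n.+1]/= /=; case: eqP => [->//|/eqP nl].
  by apply: IH; rewrite ltn_neqAle nl.
exists U, c; split=> [||l i n ln i_n u].
- split=> // [[|n]|n]; first exact: subset_refl.
    by have [] := nxtP (n, U n, (st n).2) (U1 n).
  by have [] := nxtP (n, U n, (st n).2) (U1 n).
- by move=> n; exact: (enP _ (U1 n.+1)).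
- have [_ _ _ /(_ l i ln i_n u)] := nxtP (n, U n, (st n).2) (U1 n).
  by rewrite /= stc.
Qed.

End NbhsOne.

Section OneSided.
Variables (G : topologicalGroupType) (U : nat -> set G) (c : nat -> nat -> G).
Hypothesis U1 : forall n, nbhs 1 (U n).
Hypothesis UM : forall n x y, U n.+1 x -> U n.+1 y -> U n (x * y).
Hypothesis cU : forall n x, exists i, U n.+1 ((c n i)^-1 * x).
Hypothesis Uc : forall l i n, (l < n)%N -> (i <= n)%N -> forall u, U n.+1 u ->
  U n ((c l i)^-1 * u * c l i).

(** The union of the first [j] translates [c n i * U n]. *)
Definition translates n j : set G :=
  [set x | exists2 i, (i < j)%N & U n ((c n i)^-1 * x)].

(** The elements that lie, together with their inverses, in [translates n j]. *)
Definition translates2 n j : set G :=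
  [set x | translates n j x /\ translates n j x^-1].

Let U_anti m n : (m <= n)%N -> U n `<=` U m.
Proof.
move=> /subnK <-; elim: (n - m)%N => [|k IH]; first exact: subset_refl.
move=> x Ux; apply: IH; rewrite -[x]mulg1; apply: UM => //.
exact: nbhs_singleton.
Qed.

Let translates_mono n i j : (i <= j)%N -> translates n i `<=` translates n j.
Proof. by move=> ij x [l li Ul]; exists l => //; exact: leq_trans ij. Qed.

(** Finitely many translates of [U n.+1] are covered by finitely many of the
    given translates of [U n]. *)
Let translates_bound n (I : eqType) (s : seq I) (f : I -> G) :
  exists j, forall t u, t \in s -> U n.+1 u -> translates n j (f t * u).
Proof.
have /choice[i iP] t := cU n (f t).
exists (\max_(t <- s) i t).+1 => t u ts Uu; exists (i t).
  by rewrite ltnS; exact: leq_bigmax_seq.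
by rewrite mulgA; exact: UM.
Qed.

(** If [x = c' u'] and [y = c u], then [x * y = c' c (c^-1 u' c) u], where
    [c^-1 u' c] and [u] lie in [U m]. *)
Let translates_mul m j m' j' n : (maxn m j < m'.-1)%N -> (n.+1 < m)%N ->
  exists j'', forall x y, translates m' j' x -> translates m j y ->
    translates n j'' (x * y).
Proof.
case: m' => // m'; rewrite gtn_max => /andP[mm' jm'] nm.
have [j'' j''P] := translates_bound n (enum {: 'I_j' * 'I_j})
  (fun t => c m'.+1 t.1 * c m t.2).
exists j'' => x y [i' i'j Ux] [i ij Uy].
have -> : x * y = c m'.+1 i' * c m i *
    (((c m i)^-1 * ((c m'.+1 i')^-1 * x) * c m i) * ((c m i)^-1 * y)).
  by rewrite -!mulgA !mulVKg.
apply: (j''P (Ordinal i'j, Ordinal ij)); first by rewrite mem_enum.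
apply: UM; apply: (U_anti nm) => //; apply: (U_anti (ltnW mm')).
by apply: Uc => //; lia.
Qed.

Lemma translates2_cover : graded_cover translates2.
Proof.
split.
- by move=> n i j ij x [xi xVi]; split; exact: translates_mono ij _ _.
- move=> x n; have [j jP] := translates_bound n [:: x; x^-1] id.
  have U11 : U n.+1 1 by exact: nbhs_singleton.
  by exists j; split; [have := jP x 1|have := jP x^-1 1];
    rewrite mulg1 !inE eqxx ?orbT; exact.
- by move=> n j x [? ?]; split=> //; rewrite invgK.
- move=> m j; exists (maxn m j).+2 => m' j' n hm' nm.
  have [|j'' j''P] := @translates_mul m j m' j' n _ nm.
    by move: hm'; case: m'.
  exists j'' => x y [xm xVm] [xm' xVm'] [ym yVm] [ym' yVm'].
  by split; [|rewrite invgM]; exact: j''P.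
Qed.

Lemma translates2_totally_bounded (B : set G) n :
  totally_bounded B -> exists j, B `<=` translates2 n j.
Proof.
move=> Btb; pose V := U n.+1 `&` [set u | U n.+1 u^-1].
have V1 : nbhs 1 V by apply: filterI => //; exact: nbhs1V.
have [|F /finite_seqP[s ->] BF] := Btb V°.
  by split; [exact: open_interior|exact: V1].
have [j jP] := translates_bound n [seq x | x <- s] id.
have [i iP] := translates_bound n [seq x^-1 | x <- s] id.
exists (maxn i j) => x /BF[[f fs [u /interior_subset[Uu UuV] xE]]].
move=> [u' /interior_subset[Uu' UuV'] [f' fs' xE']]; split.
  rewrite -xE; apply: translates_mono (leq_maxr _ _) _ _.
  by apply: jP => //; rewrite map_id.
rewrite -xE' invgM; apply: translates_mono (leq_maxl _ _) _ _.
by apply: iP => //; exact: map_f.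
Qed.

End OneSided.

(** In a finite power, the boxes with equal sides are a basis at the unit. *)
Lemma nbhs1_mpower (M : topologicalMonoidType) (k : nat) (V : set (mpower M k)) :
  nbhs 1 V -> exists2 B : set M, nbhs 1 B &
    forall x : mpower M k, (forall i, B (x i)) -> V x.
Proof.
pose F : set_system (mpower M k) :=
  [set A | exists2 B : set M, nbhs 1 B & forall x, (forall i, B (x i)) -> A x].
(* [F] is the filter generated by the boxes, so the claim is that it converges
   to the unit, which is a statement on each coordinate. *)
suff : F --> (1 : mpower M k) by apply.
have FF : Filter F.
  split=> [|A A' [B B1 BA] [B' B1' BA']|A A' AA' [B B1 BA]].
  - by exists setT => //; exact: filterT.
  - exists (B `&` B'); first exact: filterI.
    by move=> x xB; split; [apply: BA|apply: BA'] => i; have [] := xB i.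
  - by exists B => // x /BA; exact: AA'.
apply/cvg_sup => i A [?/= [[B oB <-]]] /= B1 /filterS; apply.
exists B; first exact: open_nbhs_nbhs.
by move=> x; exact.
Qed.

(** If [G^k] is not Menger, then neighborhoods [V n] of the unit of [G] exist
    such that, however translates of smaller neighborhoods are chosen, no
    bound [f] controls all the entries of every [k]-tuple. Otherwise, the
    tuples with entries among the [c n i], or their inverses, for [i < f n]
    would be finite sets witnessing the Menger property. *)
Lemma not_menger_tuple (G : topologicalGroupType) (k : nat) :
  ~ menger_monoid (mpower G k) -> exists2 V : nat -> set G,
    forall n, nbhs 1 (V n) &
    forall (U : nat -> set G) (c : nat -> nat -> G) (f : nat -> nat),
      (forall n, U n `<=` V n) ->
      exists x : 'I_k -> G, forall n, exists i, ~ translates2 U c n (f n) (x i).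
Proof.
move=> /existsNP[O /not_implyP[O1 nO]].
have /choice[V VP] n : exists V : set G, nbhs 1 V /\
    forall x : mpower G k, (forall i, V (x i)) -> O n x /\ O n (fun i => (x i)^-1).
  have [B B1 BO] := nbhs1_mpower (open_nbhs_nbhs (O1 n)).
  exists (B `&` [set u | B u^-1]); split.
    by apply: filterI => //; exact: nbhs1V.
  by move=> x xB; split; apply: BO => i; have [] := xB i.
exists V => [n|U c f UV]; first by have [] := VP n.
apply: contrapT => nx; apply: nO.
pose e n (g : {ffun 'I_k -> 'I_(f n)}) : mpower G k := fun i => c n (g i).
pose e' n (g : {ffun 'I_k -> 'I_(f n)}) : mpower G k := fun i => (c n (g i))^-1.
exists (fun n => range (e n) `|` range (e' n)) => [n|].
  by rewrite finite_setU; split; apply: finite_image; exact: finite_finset.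
apply/seteqP; split => // x _; apply: contrapT => nUx; apply: nx.
exists x => n; apply: contrapT => /forallNP xW; apply: nUx; exists n => //.
have {}xW i : translates2 U c n (f n) (x i) by apply: contrapT; exact: xW.
have /choice[g gP] i : exists j : 'I_(f n), U n ((c n j)^-1 * x i).
  by have [[j jf Uj] _] := xW i; exists (Ordinal jf).
have /choice[g' g'P] i : exists j : 'I_(f n), U n ((c n j)^-1 * (x i)^-1).
  by have [_ [j jf Uj]] := xW i; exists (Ordinal jf).
split.
- exists (e n (finfun g)); first by left; exists (finfun g).
  exists (fun i => (c n (g i))^-1 * x i).
    by have [_ /(_ (fun i => (c n (g i))^-1 * x i))[]] := VP n => // i; exact: UV.
  apply/funext => i.
  have -> : e n (finfun g) = fun i => c n (g i).
    by apply/funext => l; rewrite /e ffunE.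
  exact: mulVKg.
- exists (fun i => ((c n (g' i))^-1 * (x i)^-1)^-1).
    have [_ /(_ (fun i => (c n (g' i))^-1 * (x i)^-1))[]//] := VP n.
    by move=> i; exact: UV.
  exists (e' n (finfun g')); first by right; exists (finfun g').
  have -> : e' n (finfun g') = fun i => (c n (g' i))^-1.
    by apply/funext => l; rewrite /e' ffunE.
  apply/funext => i.
  rewrite -[LHS]/(((c n (g' i))^-1 * (x i)^-1)^-1 * (c n (g' i))^-1).
  by rewrite invgM !invgK mulgK.
Qed.

Lemma cfg_chain_iso (G : topologicalGroupType) (a b : wotype) :
  ord_iso a b -> cfg_chain G a -> cfg_chain G b.
Proof.
move=> /ord_iso_sym[g gm gs] [H [Hg Hinc Hcov Hsb]].
exists (H \o g); split=> [i|i j ij||B /Hsb[i Bi]].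
- exact: Hg.
- by apply: Hinc; rewrite gm.
- apply/seteqP; split => // x; rewrite Hcov => -[i _ Hx].
  by have [j ji] := gs i; exists j => //=; rewrite ji.
- by have [j ji] := gs i; exists j; rewrite /= ji.
Qed.

Theorem theorem1p3 (G : topologicalGroupType) (k : nat) (L : set_system nat) :
  omega_bounded G ->
  ~ menger_monoid (mpower G k) ->
  free_ultrafilter L ->
  (forall Q : set_system nat, Qpoint Q -> ~ coherent L Q) ->
  exists lambda kappa : wotype,
    [/\ is_cfg G lambda, is_frakb L kappa & ord_le lambda kappa].
Proof.
move=> Gob nM Lfree LnQ.
have [V V1 Vx] := not_menger_tuple nM.
have [U [c [[U1 UV UM] cU Uc]]] := omega_bounded_sequence Gob V1.
have LU : UltraFilter L by case: Lfree.
have [kappa kappaP] : exists a, is_frakb L a.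
  by apply: is_cofinality_exists => x; apply: filterS filterT => n _ /=.
have kappa_chain : cfg_chain G kappa.
  apply: (cfg_chain_frakb (W := translates2 U c)) kappaP => //.
  - exact: translates2_cover.
  - by move=> B Btb n; exact: translates2_totally_bounded.
  - by move=> h; exact: not_coherent_Qpoint_gap.
  - move=> f; apply: contrapT => /forallNP Xf.
    have [x xP] := Vx U c f UV.
    have : \forall n \near L, forall i, translates2 U c n (f n) (x i).
      by apply: filter_forall => i; apply: contrapT; exact: Xf.
    by move=> /filter_ex[n xn]; have [i] := xP n.
have [lambda lambdaP] : exists a, is_cfg G a.
  by apply: least_exists; [exact: cfg_chain_iso|exists kappa].
exists lambda, kappa; split=> //.
by case: lambdaP => _; apply.
Qed.
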